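(* As $n\to\infty$, the pseudo-exponent of the symmetric group $S_{n(n+1)/2}$ satisfies $$\alpha\bigl(S_{n(n+1)/2}\bigr)\le 2+\frac{2-\log 2}{\log n}+O\left(\frac{1}{(\log n)^2}\right).$$
   Context: $S_N$ is the symmetric group on $N$ elements and $\log$ is the natural logarithm. For a subset $S$ of a group, $Q(S)=\{s_1s_2^{-1}: s_1,s_2\in S\}$. A group $G$ realizes $\langle n_1,n_2,n_3\rangle$ if there are subsets $S_1,S_2,S_3\subseteq G$ with $|S_i|=n_i$ such that for all $q_i\in Q(S_i)$, if $q_1q_2q_3=1$ then $q_1=q_2=q_3=1$. The pseudo-exponent $\alpha(G)$ of a non-trivial finite group $G$ is the minimum of $\frac{3\log|G|}{\log nmp}$ over all positive integers $n,m,p$ (not all $1$) such that $G$ realizes $\langle n,m,p\rangle$; the pseudo-exponent of the trivial group is $3$. *)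

(* Defs.v *)
From HB Require Import structures.
From mathcomp Require Import all_boot all_order all_algebra all_fingroup.
From mathcomp Require Import all_classical all_reals all_analysis.

Set Implicit Arguments.
Unset Strict Implicit.
Unset Printing Implicit Defensive.

Import Order.TTheory GRing.Theory Num.Theory.
Import numFieldNormedType.Exports.

Local Open Scope ring_scope.

Definition quotient_set (gT : finGroupType) (S : {set gT}) : {set gT} :=
  ([set s1 * s2^-1 | s1 in S, s2 in S])%g.

Definition realizes (gT : finGroupType) (G : {group gT}) (n1 n2 n3 : nat) :
    Prop :=
  exists S1 S2 S3 : {set gT},
    [/\ S1 \subset G, S2 \subset G & S3 \subset G] /\
    [/\ #|S1| = n1, #|S2| = n2 & #|S3| = n3] /\
    forall q1 q2 q3 : gT,
      q1 \in quotient_set S1 -> q2 \in quotient_set S2 ->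
      q3 \in quotient_set S3 ->
      (q1 * q2 * q3 = 1)%g -> [/\ q1 = 1%g, q2 = 1%g & q3 = 1%g].

Definition pseudo_exponent_values (R : realType) (gT : finGroupType)
    (G : {group gT}) : set R :=
  [set x : R | exists n m p : nat,
     [/\ (0 < n)%N, (0 < m)%N & (0 < p)%N] /\
     ~ [/\ n = 1%N, m = 1%N & p = 1%N] /\
     realizes G n m p /\
     x = 3 * ln (#|G|%:R : R) / ln ((n * m * p)%:R : R)]%classic.

Arguments pseudo_exponent_values R {gT} G.

(* For nontrivial G the infimum is a minimum: see [pseudo_exponent_min]. *)
Definition pseudo_exponent (R : realType) (gT : finGroupType)
    (G : {group gT}) : R :=
  if #|G| == 1%N then 3 else inf (pseudo_exponent_values R G).

Arguments pseudo_exponent R {gT} G.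

Lemma quotient_set1 (gT : finGroupType) :
  quotient_set [set 1%g : gT] = [set 1%g : gT].
Proof.
apply/setP => x; rewrite inE; apply/imset2P/eqP.
  by case=> a b; rewrite !inE => /eqP -> /eqP -> ->; rewrite mulgV.
by move=> ->; exists 1%g 1%g; rewrite ?inE // mulgV.
Qed.

Lemma realizes_trivial (gT : finGroupType) (G : {group gT}) :
  realizes G #|G| 1 1.
Proof.
exists (G : {set gT}), [set 1%g], [set 1%g]; split; first by rewrite !sub1G.
rewrite !cards1; split=> // q1 q2 q3 _.
rewrite quotient_set1 !inE => /eqP -> /eqP ->; rewrite !mulg1.
by move=> ->.
Qed.

Lemma realizes_le (gT : finGroupType) (G : {group gT}) n m p :
  realizes G n m p -> [/\ n <= #|G|, m <= #|G| & p <= #|G|]%N.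
Proof.
by move=> [S1 [S2 [S3 [[s1 s2 s3] [[<- <- <-] _]]]]]; rewrite !subset_leq_card.
Qed.

Lemma pseudo_exponent_min (R : realType) (gT : finGroupType)
    (G : {group gT}) :
  #|G| <> 1%N ->
  pseudo_exponent_values R G (pseudo_exponent R G) /\
  lbound (pseudo_exponent_values R G) (pseudo_exponent R G).
Proof.
move=> G1.
have G2 : (1 < #|G|)%N by rewrite ltn_neqAle cardG_gt0 andbT eq_sym; apply/eqP.
pose k := #|G|.+1.
pose P (t : 'I_k * 'I_k * 'I_k) : bool :=
  `[< [/\ (0 < t.1.1)%N, (0 < t.1.2)%N & (0 < t.2)%N] /\
     ~ [/\ t.1.1 = 1%N :> nat, t.1.2 = 1%N :> nat & t.2 = 1%N :> nat] /\
     realizes G t.1.1 t.1.2 t.2 >].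
pose t0 : 'I_k * 'I_k * 'I_k := (inord #|G|, inord 1, inord 1).
have Pt0 : P t0.
  apply/asboolP; rewrite /t0 /= !inordK /k ?ltnS ?cardG_gt0 //.
  by split=> //; split; [case|exact: realizes_trivial].
pose t := [arg max_(i > t0 | P i) (i.1.1 * i.1.2 * i.2)%N].
have [Pt tmax] : P t /\
    forall j, P j -> (j.1.1 * j.1.2 * j.2 <= t.1.1 * t.1.2 * t.2)%N.
  by rewrite /t; case: arg_maxnP.
pose v : R := 3 * ln #|G|%:R / ln ((t.1.1 * t.1.2 * t.2)%N%:R).
have Vv : pseudo_exponent_values R G v.
  by move/asboolP : Pt => [? [? ?]]; exists t.1.1, t.1.2, t.2.
have Lv : lbound (pseudo_exponent_values R G) v.
  move=> x [n [m [p [[n0 m0 p0] [nmp1 [rnmp ->]]]]]].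
  have [nG mG pG] := realizes_le rnmp.
  have Pj : P (inord n, inord m, inord p).
    by apply/asboolP; rewrite /= !inordK /k ?ltnS.
  have := tmax _ Pj; rewrite /= !inordK /k ?ltnS // => le_t.
  have nmp_gt1 : (1 < n * m * p)%N.
    rewrite ltn_neqAle !muln_gt0 n0 m0 p0 !andbT eq_sym.
    apply/negP; rewrite !muln_eq1 => /andP[/andP[/eqP ? /eqP ?] /eqP ?].
    by apply: nmp1.
  have lnmp : 0 < ln ((n * m * p)%:R : R) by rewrite ln_gt0 // ltr1n.
  have lln : ln ((n * m * p)%:R : R) <= ln ((t.1.1 * t.1.2 * t.2)%N%:R).
    by rewrite ler_ln ?ler_nat // posrE ltr0n ?(leq_trans _ le_t) // ltnW.
  rewrite /v ler_wpM2l //.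
    by rewrite mulr_ge0 // ln_ge0 // ler1n.
  by rewrite lef_pV2 // posrE // (lt_le_trans lnmp).
suff -> : pseudo_exponent R G = v by [].
rewrite /pseudo_exponent (introF eqP G1).
apply/le_anti/andP; split.
  by apply: ge_inf => //; exists v.
by apply: lb_le_inf => //; exists v.
Qed.

(* Main.v *)
(** Identify the n(n+1)/2 points with the triangle {(a, b, c) : a + b + c = n - 1}
    and let H1, H2, H3 be the subgroups of permutations that preserve the first,
    second and third coordinate.  Each has order 1! 2! ... n!, and they satisfy
    the triple product property: if q1 q2 q3 = 1, follow a point t and consider
    the sum over t of (a(t) + b(q1 t) + c(t) - (n - 1))^2.  Expanding the square
    only involves two coordinates at a time, and each pair of coordinates can be
    read off at a single point (t, q1 t or q2 (q1 t)), which runs over the whole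
    triangle; so the sum has the value it has for q1 = q2 = q3 = 1, namely 0.
    Hence q1 preserves two coordinates, and so is trivial.
    The pseudo-exponent is thus at most ln (n(n+1)/2)! / ln (1! 2! ... n!), where
    Stirling gives n^2/2 (2 ln n - ln 2 - 1) + O(n ln n) over
    n^2/2 (ln n - 3/2) + O(n). *)
Require Import Defs.
From HB Require Import structures.
From mathcomp Require Import all_boot all_order all_algebra all_fingroup.
From mathcomp Require Import all_classical all_reals all_analysis.
From mathcomp Require Import zify ring lra.

Set Implicit Arguments.
Unset Strict Implicit.
Unset Printing Implicit Defensive.

Import Order.TTheory GRing.Theory Num.Theory.
Import numFieldNormedType.Exports.

Local Open Scope ring_scope.

(** * Permutations preserving a function, and how many there are *)

Section FiberPerm.
Variables (T : finType) (f : T -> nat).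

Definition fiber_perm : {set {perm T}} :=
  [set s : {perm T} | [forall t, f (s t) == f t]].

Lemma fiber_permP (s : {perm T}) :
  reflect (forall t, f (s t) = f t) (s \in fiber_perm).
Proof.
by rewrite inE; apply: (iffP forallP) => h t; apply/eqP; rewrite h.
Qed.

Lemma quotient_set_fiber_perm (s : {perm T}) :
  s \in quotient_set fiber_perm -> s \in fiber_perm.
Proof.
case/imset2P => u v /fiber_permP fu /fiber_permP fv ->.
by apply/fiber_permP => t; rewrite permM -fv permKV fu.
Qed.

(** The fibres of [f] can be permuted independently, so the group contains a product of symmetric
    groups. The product is built one fibre at a time: [K m] holds the permutations that move only
    points with [f t < m]. *)
Lemma prod_leq_fact_fiber_perm (c : nat -> nat) n :
  (forall k, (k < n)%N -> (c k <= #|[set t | f t == k]|)%N) ->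
  (\prod_(k < n) (c k)`! <= #|fiber_perm|)%N.
Proof.
pose K m := [set s : {perm T} |
    (s \in fiber_perm) && [forall t, (m <= f t)%N ==> (s t == t)]].
have KP m (s : {perm T}) : reflect ((forall t, f (s t) = f t) /\
    (forall t, (m <= f t)%N -> s t = t)) (s \in K m).
  rewrite inE; apply: (iffP andP) => -[/fiber_permP fs ms]; split=> //.
    by move=> t mt; apply/eqP; move/forallP/(_ t)/implyP : ms; apply.
  by apply/forallP => t; apply/implyP => mt; rewrite ms.
move=> cf; suff : forall m, (m <= n)%N ->
    (\prod_(k < m) (c k)`! <= #|K m|)%N.
  move=> /(_ _ (leqnn n)) /leq_trans; apply; apply: subset_leq_card.
  by apply/fintype.subsetP => s; rewrite inE => /andP[].
elim=> [_|m IH mn].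
  rewrite big_ord0 card_gt0; apply/set0Pn; exists 1%g.
  by apply/KP; split=> t *; rewrite perm1.
rewrite big_ord_recr /=.
pose F := [set t | f t == m].
pose X := finset.setX (K m) (finset (perm_on F)).
have FP u : u \in perm_on F -> forall t, (f t != m -> u t = t) /\ f (u t) = f t.
  move=> uF t; split=> [ft|]; first by rewrite (out_perm uF) // inE.
  case: (eqVneq (f t) m) => [ft|ft]; last by rewrite (out_perm uF) // inE.
  have : u t \in F by rewrite (perm_closed _ uF) inE ft.
  by rewrite inE => /eqP ->.
have XP s u : (s, u) \in X -> s \in K m /\ u \in perm_on F.
  by rewrite finset.in_setX => /andP[sK]; rewrite inE.
(* The product determines [s]: where [m <= f t], [s] is the identity, and elsewhere [u] fixes [s t],
   so the product agrees with [s]. *)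
have inj : {in X &, injective (fun p : {perm T} * {perm T} => (p.1 * p.2)%g)}.
  move=> [s u] [s' u'] /XP[/KP[fs ms] /FP uF] /XP[/KP[fs' ms'] /FP uF'] /= e.
  have ss : s = s'.
    apply/permP => t; have [mt|tm] := leqP m (f t); first by rewrite ms ?ms'.
    have := congr1 (fun v : {perm T} => v t) e; rewrite /= !permM.
    by rewrite (proj1 (uF _)) ?(proj1 (uF' _)) // ?fs ?fs' ltn_eqF.
  by move: e; rewrite ss => /mulgI ->.
have sub : [set (p.1 * p.2)%g | p in X] \subset K m.+1.
  apply/fintype.subsetP => _ /imsetP[[s u] /XP[/KP[fs ms] /FP uF] ->] /=.
  apply/KP; split=> t.
    by rewrite permM (proj2 (uF _)) fs.
  by move=> mt; rewrite permM ms ?(proj1 (uF _)) // ?gtn_eqF // ltnW.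
apply: leq_trans (subset_leq_card sub); rewrite card_in_imset // cardsX.
apply: leq_mul; first exact/IH/ltnW.
rewrite cardsE card_perm; apply: leq_fact; exact: cf.
Qed.

End FiberPerm.

(** * The triple product property *)

Lemma fiber_perm_tpp (T : finType) (a b c : T -> nat) (m : nat) :
    (forall t, (a t + b t + c t = m)%N) ->
    (forall s t, a s = a t -> b s = b t -> s = t) ->
  forall q1 q2 q3 : {perm T},
    q1 \in fiber_perm a -> q2 \in fiber_perm b -> q3 \in fiber_perm c ->
    (q1 * q2 * q3 = 1)%g -> [/\ q1 = 1%g, q2 = 1%g & q3 = 1%g].
Proof.
move=> abc inj q1 q2 q3 /fiber_permP a1 /fiber_permP b2 /fiber_permP c3 q123.
have cyc t : q3 (q2 (q1 t)) = t by rewrite -!permM ?mulgA q123 perm1.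
(* [q3] carries [q2 (q1 t)] back to [t] and preserves [c]. *)
have c2 t : c (q2 (q1 t)) = c t by rewrite -[in RHS](cyc t) c3.
pose A t : int := (a t)%:Z; pose B t : int := (b t)%:Z.
pose C t : int := (c t)%:Z; pose M : int := m%:Z.
have ABC t : A t + B t + C t - M = 0.
  by rewrite /A /B /C /M -(abc t) !PoszD subrr.
(* The monomials of [(A + B + C - M) ^+ 2] are split by the pair of coordinates involved: [F1] will
   be read at [q1 t], [F2] at [q2 (q1 t)] and [F3] at [t]. *)
pose F1 t := A t ^+ 2 + 2 * A t * B t - 2 * M * A t.
pose F2 t := B t ^+ 2 + 2 * B t * C t - 2 * M * B t.
pose F3 t := C t ^+ 2 + 2 * A t * C t - 2 * M * C t + M ^+ 2.
have sq0 : \sum_t (A t + B (q1 t) + C t - M) ^+ 2 = 0.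
  transitivity (\sum_t (F1 (q1 t) + F2 ((q1 * q2)%g t) + F3 t)).
    apply: eq_bigr => t _; rewrite /F1 /F2 /F3 /A /B /C permM a1 b2 c2.
    ring.
  have sum_perm (q : {perm T}) (F : T -> int) : \sum_t F (q t) = \sum_t F t.
    by rewrite [RHS](reindex_inj (@perm_inj _ q)).
  rewrite 2!big_split /= (sum_perm q1 F1) (sum_perm (q1 * q2)%g F2).
  rewrite -2!big_split /=.
  apply: big1 => t _; have -> : F1 t + F2 t + F3 t = (A t + B t + C t - M) ^+ 2.
    by rewrite /F1 /F2 /F3; ring.
  by rewrite ABC expr0n.
have b1 t : b (q1 t) = b t.
  have := psumr_eq0P (fun t _ => sqr_ge0 (A t + B (q1 t) + C t - M)) sq0.
  move=> /(_ t isT)/eqP; rewrite expf_eq0 /= => /eqP e.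
  by have := ABC t; rewrite /A /B /C /M in e *; lia.
have q1t t : q1 t = t by apply: inj.
(* With [q1] trivial, [q2] preserves both [b] and [c], hence also [a], since the three sum to
   [m]. *)
have q2t t : q2 t = t.
  apply: inj => //; have := abc (q2 t); have := abc t.
  by rewrite b2 -[in c (q2 t)](q1t t) c2; lia.
split; apply/permP => t; rewrite perm1 //.
by rewrite -[in LHS](q1t t) -[in LHS](q2t (q1 t)) cyc.
Qed.

(** * The triangle and its three subgroups *)

(** Only two coordinates are stored; the third is [n.-1] minus their sum. *)
Definition triangle (n : nat) : predArgType :=
  {p : 'I_n * 'I_n | (p.1 + p.2 < n)%N}.

Lemma card_triangle n : #|{: triangle n}| = ((n * (n + 1)) %/ 2)%N.
Proof.
rewrite card_sig -sum1_card.
rewrite -(pair_big_dep xpredT (fun i j : 'I_n => (i + j < n)%N)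
  (fun _ _ => 1%N)) /=.
transitivity (\sum_(i < n) (n - i))%N.
  apply: eq_bigr => i _; rewrite sum1_card.
  rewrite -[RHS]card_ord.
  have le : (n - i <= n)%N by lia.
  have winj : injective (widen_ord le).
    by move=> u v /(congr1 val) /= /val_inj.
  rewrite -(fintype.card_image winj).
  apply: eq_card => j; apply/idP/fintype.imageP.
    rewrite unfold_in /= => ij; have jn : (j < n - i)%N by lia.
    by exists (Ordinal jn) => //; apply: val_inj.
  by case=> k _ ->; rewrite unfold_in /=; have := ltn_ord k; lia.
transitivity (\sum_(i < n) i.+1)%N.
  rewrite (reindex_inj rev_ord_inj); apply: eq_bigr => i _ /=.
  by have := ltn_ord i; lia.
elim: n => [|n IH]; first by rewrite big_ord0.
rewrite big_ord_recr /= IH addn1 addn1 -(addn2 n).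
have -> : (n.+1 * (n + 2) = n.+1 * 2 + n * n.+1)%N by lia.
by rewrite divnMDl // addnC.
Qed.

(** The triangle is transported to ['I_N] by the bijections [g] and [h]. Lower bounds on the three
    orders are enough for an upper bound on the pseudo-exponent. *)
Lemma realizes_triangle n : exists n1 n2 n3 : nat,
  [/\ realizes [set: 'S_((n * (n + 1)) %/ 2)]%G n1 n2 n3,
    \prod_(k < n) (k.+1)`! <= n1, \prod_(k < n) (k.+1)`! <= n2
    & \prod_(k < n) (k.+1)`! <= n3]%N.
Proof.
pose N := ((n * (n + 1)) %/ 2)%N.
pose g (i : 'I_N) : triangle n :=
  enum_val (cast_ord (esym (card_triangle n)) i).
pose h (t : triangle n) : 'I_N := cast_ord (card_triangle n) (enum_rank t).
have gh : cancel h g by move=> t; rewrite /g /h cast_ordK enum_rankK.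
have hg : cancel g h by move=> i; rewrite /g /h enum_valK cast_ordKV.
pose a i : nat := (val (g i)).1.
pose b i : nat := (val (g i)).2.
pose c i : nat := (n.-1 - (a i + b i))%N.
have abn i : (a i + b i < n)%N by exact: (valP (g i)).
have abc i : (a i + b i + c i = n.-1)%N by rewrite /c; have := abn i; lia.
have inj i j : a i = a j -> b i = b j -> i = j.
  move=> aij bij; apply: (can_inj hg); apply: val_inj.
  move: aij bij; rewrite /a /b; case: (val (g i)) (val (g j)) => [x y] [x' y'] /=.
  by move=> /val_inj -> /val_inj ->.
have ex x y : (x + y < n)%N -> exists i, a i = x /\ b i = y.
  move=> xy; have xn : (x < n)%N by lia.
  have yn : (y < n)%N by lia.
  by exists (h (exist _ (Ordinal xn, Ordinal yn) xy)); rewrite /a /b gh.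
(* A second coordinate [u] takes every value below [n - k] on the fibre [f = k], which bounds its
   size from below. *)
have card_fib (f u : 'I_N -> nat) k :
    (forall j, (j < n - k)%N -> exists i, f i = k /\ u i = j) ->
    (n - k <= #|[set i | f i == k]|)%N.
  move=> fu.
  have fu' (j : 'I_(n - k)) : exists i, (f i == k) && (u i == j).
    by have [i [fi ui]] := fu _ (ltn_ord j); exists i; rewrite fi ui !eqxx.
  pose e j := xchoose (fu' j).
  have einj : injective e.
    move=> j j' ejj; apply: ord_inj.
    have /andP[_ /eqP <-] := xchooseP (fu' j).
    by have /andP[_ /eqP <-] := xchooseP (fu' j'); rewrite -/(e j) ejj.
  rewrite -[X in (X <= _)%N]card_ord -(card_imset _ einj) subset_leq_card //.
  apply/fintype.subsetP => _ /imsetP[j _ ->]; rewrite inE.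
  by have /andP[] := xchooseP (fu' j).
have le (f u : 'I_N -> nat) :
    (forall j k, (j + k < n)%N -> exists i, f i = k /\ u i = j) ->
    (\prod_(k < n) (k.+1)`! <= #|fiber_perm f|)%N.
  move=> fu.
  have -> : (\prod_(k < n) (k.+1)`! = \prod_(k < n) (n - k)`!)%N.
    rewrite (reindex_inj rev_ord_inj); apply: eq_bigr => i _ /=.
    by congr (_`!); have := ltn_ord i; lia.
  apply: (@prod_leq_fact_fiber_perm _ _ (fun k => n - k)%N) => k kn.
  by apply: (card_fib _ u) => j jk; apply: fu; lia.
exists #|fiber_perm a|, #|fiber_perm b|, #|fiber_perm c|; split.
- exists (fiber_perm a), (fiber_perm b), (fiber_perm c).
  split; first by rewrite !finset.subsetT.
  split=> // q1 q2 q3 /quotient_set_fiber_perm h1 /quotient_set_fiber_perm h2.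
  move=> /quotient_set_fiber_perm h3.
  exact: fiber_perm_tpp abc inj _ _ _ h1 h2 h3.
- by apply: (le _ b) => j k jk; apply: ex; rewrite addnC.
- by apply: (le _ a) => j k jk; have [i []] := ex _ _ jk; exists i.
- apply: (le _ a) => j k jk.
  (* The point with [a = j] and [c = k] has this second coordinate. *)
  have [|i [ai bi]] := ex j (n.-1 - (j + k))%N; first by lia.
  by exists i; rewrite /c ai bi; split=> //; lia.
Qed.

(** * Bounds for logarithms of factorials and superfactorials *)

Section LogBounds.
Variable R : realType.
Implicit Types x : R.

(** This bound and the next are ln(1 + y) <= y at y = 1/x and y = -1/(x + 1). They are the induction
    steps of the Stirling bounds below. *)
Lemma ln_succ_ub x : 0 < x -> x * (ln (x + 1) - ln x) <= 1.
Proof.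
move=> x0; have x1 : 0 < x + 1 by lra.
rewrite -ln_div ?posrE //.
have -> : (x + 1) / x = 1 + x^-1 by field; lra.
have xV : 0 < x^-1 by rewrite invr_gt0.
have /(ler_wpM2l (ltW x0)) := @le_ln1Dx R x^-1 ltac:(lra).
by rewrite mulfV ?gt_eqF.
Qed.

Lemma ln_succ_lb x : 0 < x -> 1 <= (x + 1) * (ln (x + 1) - ln x).
Proof.
move=> x0; have x1 : 0 < x + 1 by lra.
have xV : (x + 1)^-1 < 1 by rewrite invf_lt1 //; lra.
have /(ler_wpM2l (ltW x1)) := @le_ln1Dx R (- (x + 1)^-1) ltac:(lra).
have -> : 1 + - (x + 1)^-1 = x / (x + 1) by field; lra.
rewrite ln_div ?posrE // mulrN mulfV ?gt_eqF //; lra.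
Qed.

Lemma ln_fact_lb n : n%:R * ln n%:R - n%:R <= ln (n`!%:R : R).
Proof.
elim: n => [|[|n] IH]; first by rewrite fact0 ln1 mul0r subr0.
  by rewrite factS fact0 ln1 mulr0; lra.
rewrite factS natrM lnM ?posrE ?ltr0n ?fact_gt0 //.
have := @ln_succ_ub n.+1%:R (ltr0Sn _ _); rewrite natr1.
by move: IH; rewrite -(natr1 n.+1); lra.
Qed.

(** The coefficient [n%:R + 1] makes the induction step exactly [ln_succ_lb]; the excess of order ln
    n is harmless. *)
Lemma ln_fact_ub n : (0 < n)%N ->
  ln (n`!%:R : R) <= (n%:R + 1) * ln n%:R - n%:R + 1.
Proof.
case: n => // n _; elim: n => [|n IH].
  by rewrite factS fact0 ln1 mulr0; lra.
rewrite factS natrM lnM ?posrE ?ltr0n ?fact_gt0 //.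
have := @ln_succ_lb n.+1%:R (ltr0Sn _ _); rewrite natr1.
by move: IH; rewrite -(natr1 n.+1); lra.
Qed.

(* [n^2 / 2 * ln n - n^2 / 4] is the integral of [t ln t] over [0, n]. *)
Lemma ln_superfactorial_lb n :
  n%:R ^+ 2 / 2 * ln n%:R - 3 / 4 * n%:R ^+ 2 - n%:R / 2
    <= ln ((\prod_(k < n) (k.+1)`!)%:R : R).
Proof.
elim: n => [|n IH]; first by rewrite big_ord0 ln1 expr0n /= !(mul0r, mulr0); lra.
have P0 : (0 < \prod_(k < n) (k.+1)`!)%N.
  by rewrite prodn_gt0 // => k; exact: fact_gt0.
rewrite big_ord_recr /= natrM lnM ?posrE ?ltr0n ?fact_gt0 //.
apply: le_trans (lerD IH (ln_fact_lb n.+1)).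
case: n {IH P0} => [|n]; first by rewrite expr0n ln1 !(mul0r, mulr0) /=; lra.
set x : R := n.+1%:R; have x1 : 1 <= x by rewrite ler1n.
have x0 : 0 < x by lra.
rewrite -(natr1 n.+1) -/x.
(* After cancellation, the induction step asks that x^2 (ln(x + 1) - ln x) be at most x + 1/2 + ln(x
   + 1). *)
have := ler_wpM2l (ltW x0) (ln_succ_ub x0).
have : 0 <= ln (x + 1) by rewrite ln_ge0 //; lra.
nra.
Qed.

(** Twice the logarithm of the square root is at most twice the square root. This lets terms of size
    1/x be absorbed into 1/(ln x)^2. *)
Lemma sqr_ln_le n : (0 < n)%N -> ln (n%:R : R) ^+ 2 <= 4 * n%:R.
Proof.
move=> n0; set x : R := n%:R; have x1 : 1 <= x by rewrite ler1n.
set s := Num.sqrt x; have s0 : 0 < s by rewrite sqrtr_gt0; lra.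
have xs : x = s ^+ 2 by rewrite sqr_sqrtr; lra.
have l0 : 0 <= ln x by rewrite ln_ge0.
have : ln x <= 2 * s by rewrite xs lnXn // mulr2n; have := ln_sublinear s0; lra.
by move=> ls; rewrite [leRHS](_ : _ = 4 * s ^+ 2) -?xs //; nra.
Qed.

(** Here [l] stands for ln x and [d] for ln 2. The left side is the Stirling upper bound for ln N!
    with N = x(x + 1)/2, and the first factor on the right is the superfactorial lower bound. Both
    sides are divided by x^2/2 and expanded in [b], the inverse of [l]. *)
Lemma ln_ratio_bound (x l d : R) :
    1 <= x -> 10 <= l -> l ^+ 2 <= 4 * x -> 0 <= d <= 1 ->
  (x * (x + 1) / 2 + 1) * (2 * l + x^-1 - d) - x * (x + 1) / 2 + 1 <=
  (x ^+ 2 / 2 * l - 3 / 4 * x ^+ 2 - x / 2) *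
    (2 + (2 - d) / l + 100 / l ^+ 2).
Proof.
move=> x1 l10 lx /andP[d0 d1].
have x0 : 0 < x by lra.
have l0 : 0 < l by lra.
pose a := x^-1; pose b := l^-1.
have ax : a * x = 1 by rewrite mulVf // gt_eqF.
have bl : b * l = 1 by rewrite mulVf // gt_eqF.
have a0 : 0 < a by rewrite invr_gt0.
have b0 : 0 < b by rewrite invr_gt0.
have a1 : a <= 1 by rewrite invf_le1.
have b1 : b <= 1 / 10 by nra.
have ab : a <= 4 * b ^+ 2.
  have h : 0 <= a * b ^+ 2 by apply: mulr_ge0; [exact: ltW|exact: sqr_ge0].
  have := ler_wpM2l h lx.
  have -> : a * b ^+ 2 * l ^+ 2 = a * (b * l) ^+ 2 by ring.
  have -> : a * b ^+ 2 * (4 * x) = 4 * b ^+ 2 * (a * x) by ring.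
  by rewrite ax bl expr1n !mulr1.
have al : a * l <= 4 * b.
  have := ler_wpM2r (ltW l0) ab.
  have -> : 4 * b ^+ 2 * l = 4 * b * (b * l) by ring.
  by rewrite bl mulr1.
have al10 : 10 * a <= a * l by rewrite [leLHS]mulrC ler_wpM2l // ltW.
have aa : a ^+ 2 <= a by rewrite expr2 ger_pMr // lra.
have -> : x * (x + 1) / 2 = x ^+ 2 / 2 * (1 + a) by rewrite /a; field; lra.
(* The main error [6 * a * l] is at most [24 * b]; since [a <= 4 / 10 * b], the rest fits in
   [4 * b]. *)
have A1 : (1 + a + 2 * a ^+ 2) * (2 * l + a - d) - 1 - a + 2 * a ^+ 2
    <= 2 * l - d - 1 + 28 * b.
  have : (a + 2 * a ^+ 2) * (2 * l + a - d) <= (3 * a) * (2 * l + 1).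
    by have a2 := sqr_ge0 a; apply: ler_pM; lra.
  lra.
have bb : b ^+ 2 <= b / 10 by rewrite expr2 ler_wpM2l //; lra.
have b2 : 0 <= b ^+ 2 by exact: sqr_ge0.
have db : d * b <= b by rewrite ger_pMl.
have db0 : 0 <= d * b by rewrite mulr_ge0 // ltW.
have db2 : 0 <= d * b ^+ 2 by rewrite mulr_ge0.
have b3 : b ^+ 3 <= b / 100 by rewrite exprS; have := ler_wpM2l (ltW b0) bb; lra.
(* The constant terms agree, as -3 + (2 - d) = -d - 1; at order [b], the 100 outweighs 28 and all
   negative terms. *)
have B1 : 2 * l - d - 1 + 28 * b <=
    (l - 3 / 2 - a) * (2 + (2 - d) * b + 100 * b ^+ 2).
  have T0 : 0 <= 2 + (2 - d) * b + 100 * b ^+ 2 by lra.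
  have : (l - 3 / 2 - b) * (2 + (2 - d) * b + 100 * b ^+ 2) <=
      (l - 3 / 2 - a) * (2 + (2 - d) * b + 100 * b ^+ 2).
    by apply: ler_wpM2r => //; lra.
  apply: le_trans.
  have -> : (l - 3 / 2 - b) * (2 + (2 - d) * b + 100 * b ^+ 2) =
     2 * l - 3 + (2 - d) * (b * l) + 100 * b * (b * l)
     - 3 / 2 * ((2 - d) * b + 100 * b ^+ 2)
     - (2 * b + (2 - d) * b ^+ 2 + 100 * b ^+ 3) by field.
  rewrite bl; lra.
have x2 : 0 <= x ^+ 2 / 2 by have := sqr_ge0 x; lra.
have := ler_wpM2l x2 (le_trans A1 B1).
have -> : (2 - d) / l = (2 - d) * b by [].
have -> : 100 / l ^+ 2 = 100 * b ^+ 2 by rewrite exprVn.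
have e2 : x ^+ 2 * a ^+ 2 = 1 by rewrite -exprMn mulrC ax expr1n.
have e1 : x ^+ 2 * a = x by rewrite expr2 -mulrA [x * a]mulrC ax mulr1.
move=> h; apply: le_trans (le_trans h _); rewrite le_eqVlt; apply/orP; left.
  apply/eqP; rewrite -/a.
  transitivity (x ^+ 2 / 2 * (1 + a) * (2 * l + a - d) +
     x ^+ 2 * a ^+ 2 * (2 * l + a - d) - x ^+ 2 / 2 * (1 + a) + x ^+ 2 * a ^+ 2).
    by rewrite e2; ring.
  by field.
apply/eqP; transitivity ((x ^+ 2 / 2 * l - 3 / 4 * x ^+ 2 - x ^+ 2 * a / 2) *
   (2 + (2 - d) * b + 100 * b ^+ 2)); first by field.
by rewrite e1.
Qed.

End LogBounds.

(** * From the realized triple to the asymptotic bound *)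

Lemma pseudo_exponent_le (R : realType) (gT : finGroupType) (G : {group gT})
    (P n m p : nat) :
  (1 < P)%N -> [/\ P <= n, P <= m & P <= p]%N -> realizes G n m p ->
  pseudo_exponent R G <= ln (#|G|%:R : R) / ln P%:R.
Proof.
move=> P1 [Pn Pm Pp] rG.
have [nG _ _] := realizes_le rG.
have G1 : #|G| <> 1%N by lia.
have [_ lb] := pseudo_exponent_min R G1.
have P0 : 0 < ln (P%:R : R) by rewrite ln_gt0 // ltr1n.
(* Since [P ^ 3 <= n * m * p], the 3 in the pseudo-exponent cancels. *)
have le3 : 3 * ln (P%:R : R) <= ln ((n * m * p)%:R : R).
  rewrite mulrC -[3]/(3%:R) mulr_natr -lnXn ?ltr0n; last by lia.
  rewrite ler_ln ?posrE ?exprn_gt0 ?ltr0n ?muln_gt0; try lia.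
  by rewrite -natrX ler_nat !expnS expn0 muln1 mulnA !leq_mul.
apply: le_trans (_ : 3 * ln (#|G|%:R : R) / ln ((n * m * p)%:R : R) <= _).
  apply: lb; exists n, m, p; split; first by split; lia.
  by split=> [[]|]; [lia|].
have -> : ln (#|G|%:R : R) / ln P%:R = 3 * ln (#|G|%:R : R) / (3 * ln P%:R).
  by field; rewrite gt_eqF.
rewrite ler_wpM2l ?mulr_ge0 ?ln_ge0 ?ler1n ?cardG_gt0 //.
rewrite lef_pV2 ?posrE //; lra.
Qed.

Local Open Scope classical_set_scope.

Theorem theorem3p3 (R : realType) :
  exists err : nat -> R,
    err =O_\oo (fun n : nat => 1 / ln (n%:R : R) ^+ 2) /\
    \forall n \near \oo,
      pseudo_exponent R [set: 'S_((n * (n + 1)) %/ 2)]%G <=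
        2 + (2 - ln 2) / ln (n%:R : R) + err n.
Proof.
exists (fun n => 100 / ln (n%:R : R) ^+ 2); split.
  apply/eqO_exP; exists 100 => //; near=> n.
  by rewrite div1r normrM ger0_norm.
near=> n.
(* This threshold gives the hypothesis [10 <= l] of [ln_ratio_bound]. *)
have nexp : expR 10 <= n%:R :> R by near: n; exact: nbhs_infty_ger.
set x : R := n%:R in nexp *; set l := ln x.
have x0 : 0 < x by exact: lt_le_trans (expR_gt0 _) nexp.
have n0 : (0 < n)%N by move: x0; rewrite ltr0n.
have x1 : 1 <= x by rewrite ler1n.
have l10 : 10 <= l by rewrite -[10](@expRK R) ler_ln // posrE expR_gt0.
have [n1 [n2 [n3 [rG P1 P2 P3]]]] := realizes_triangle n.
set P := (\prod_(k < n) _)%N in P1 P2 P3.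
pose D := x ^+ 2 / 2 * l - 3 / 4 * x ^+ 2 - x / 2.
have DP : D <= ln (P%:R : R) by exact: ln_superfactorial_lb.
have D0 : 0 < D.
  have -> : D = x / 2 * (x * (l - 3 / 2) - 1) by rewrite /D; field.
  apply: mulr_gt0; first lra.
  have : x * 1 <= x * (l - 5 / 2) by apply: ler_wpM2l; lra.
  lra.
have Pgt1 : (1 < P)%N.
  rewrite ltnNge; apply/negP => P1'; have : (P%:R : R) <= 1 by rewrite lern1.
  by move/ln_le0; lra.
apply: le_trans (pseudo_exponent_le R Pgt1 (And3 P1 P2 P3) rG) _.
have lP : 0 < ln (P%:R : R) by exact: lt_le_trans DP.
have ln2 : 0 <= ln (2 : R) <= 1.
  by rewrite ln_ge0 ?ler1n //=; have := @le_ln1Dx R 1 ltac:(lra).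
have T0 : 0 <= 2 + (2 - ln 2) / l + 100 / l ^+ 2.
  by rewrite !addr_ge0 ?divr_ge0 ?sqr_ge0 //; lra.
rewrite ler_pdivrMr //.
apply: le_trans (_ : D * (2 + (2 - ln 2) / l + 100 / l ^+ 2) <= _); last first.
  by rewrite mulrC ler_wpM2l.
apply: le_trans (ln_ratio_bound x1 l10 (sqr_ln_le _ n0) ln2).
set N := ((n * (n + 1)) %/ 2)%N.
have N2 : (2 * N = n * (n + 1))%N.
  by rewrite /N mulnC divnK // dvdn2 oddM oddD /= addbT andbN.
have NE : (N%:R : R) = x * (x + 1) / 2.
  apply: (@mulfI _ 2); first lra.
  by rewrite -natrM N2 natrM natrD; field.
have N0 : (0 < N)%N by lia.
rewrite cardsT card_Sn.
apply: le_trans (ln_fact_ub R N0) _.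
(* ln N = ln x + ln(x + 1) - ln 2, and ln(x + 1) exceeds ln x by at most 1/x. *)
have lN : ln (N%:R : R) <= 2 * l + x^-1 - ln 2.
  have x1' : 0 < x + 1 by lra.
  rewrite NE ln_div ?lnM ?posrE ?mulr_gt0 //.
  have : ln (x + 1) - ln x <= x^-1.
    by rewrite -(ler_pM2l x0) mulfV ?gt_eqF // ln_succ_ub.
  rewrite -/l; lra.
have : (N%:R + 1) * ln (N%:R : R) <= (N%:R + 1) * (2 * l + x^-1 - ln 2).
  by rewrite ler_wpM2l // addr_ge0.
by rewrite NE; lra.
Unshelve. all: by end_near. Qed.
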